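(* For integers $n\ge2$ and $0\le t\le n-2$, the number of $(102,011)$-avoiding inversion sequences $e$ of length $n$ with $\mathrm{rank}(e)=t$ is $F_{2n-2t-2}$, where $F_k$ denotes the $k$-th Fibonacci number ($F_0=0$, $F_1=1$, $F_k=F_{k-1}+F_{k-2}$).
   Context: An inversion sequence of length $n$ is an integer sequence $e=(e_1,\dots,e_n)$ with $0\le e_j\le j-1$ for all $j$. It contains a pattern $w=w_1w_2w_3$ if there are indices $i_1<i_2<i_3$ such that $e_{i_1}e_{i_2}e_{i_3}$ is order-isomorphic to $w$ (same relations $<,=,>$ between corresponding pairs of entries); otherwise it avoids $w$. ''$(w,w')$-avoiding'' means avoiding both $w$ and $w'$. $\max(e)$ is the largest entry, and $\mathrm{fdes}(e)$ is the position $p$ of the first descent: $e_1\le\cdots\le e_p>e_{p+1}$, with the convention $e_{n+1}=-1$. For a $102$-avoiding $e$, $\mathrm{rank}(e):=\mathrm{fdes}(e)-\max(e)-1$. *)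

(* Defs.v *)
From mathcomp Require Import all_boot all_order all_algebra.

Set Implicit Arguments.
Unset Strict Implicit.
Unset Printing Implicit Defensive.

(* Sequences are 0-indexed: the entry e_j of e = (e_1, ..., e_n) is
   [nth 0 e j.-1], so the bound e_j <= j - 1 reads [nth 0 e i <= i]. *)
Definition inversion_seq (e : seq nat) : bool :=
  [forall i : 'I_(size e), nth 0 e i <= i].

Definition order_iso (s w : seq nat) : bool :=
  (size s == size w) &&
  [forall a : 'I_(size w), forall b : 'I_(size w),
     ((nth 0 s a < nth 0 s b) == (nth 0 w a < nth 0 w b)) &&
     ((nth 0 s a == nth 0 s b) == (nth 0 w a == nth 0 w b))].

(* [w] is meant to have length 3. *)
Definition contains (w e : seq nat) : bool :=
  [exists i1 : 'I_(size e), exists i2 : 'I_(size e), exists i3 : 'I_(size e),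
     [&& i1 < i2, i2 < i3 &
         order_iso [:: nth 0 e i1; nth 0 e i2; nth 0 e i3] w]].

Definition avoids (w e : seq nat) : bool := ~~ contains w e.

Definition maxe (e : seq nat) : nat := \max_(x <- e) x.

(* The default value -1 of [nth] implements the convention e_{n+1} = -1, and
   the outer successor turns the 0-based index of the first descent into the
   1-based position. *)
Definition fdes (e : seq nat) : nat :=
  let z := [seq Posz x | x <- e] in
  (find (fun p => (nth (-1)%R z p.+1 < nth (-1)%R z p)%R)
        (iota 0 (size e))).+1.

Definition rank (e : seq nat) : int :=
  ((fdes e)%:Z - (maxe e)%:Z - 1)%R.

Fixpoint fib (k : nat) : nat :=
  match k with
  | 0 => 0
  | k1.+1 => match k1 with 0 => 1 | k2.+1 => fib k1 + fib k2 end
  end.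

(* The entries of an inversion sequence of length n are all < n, so these
   sequences are exactly those underlying some [n.-tuple 'I_n]. *)
Definition avoiders_of_rank (n t : nat) : {set n.-tuple 'I_n} :=
  [set u : n.-tuple 'I_n |
    let e := [seq val x | x <- u] in
    [&& inversion_seq e, avoids [:: 1; 0; 2] e, avoids [:: 0; 1; 1] e
      & rank e == Posz t]].

(* Main.v *)
(* For e of the required kind, avoiding 011 says that the positive entries are
   distinct, and avoiding 102 that the first descent occurs at the maximum M,
   so rank t fixes the 1-based position of M to be M + t + 1. Put
   m = n - t - 2, let N(m) count these sequences and U(m) those in which 1
   occurs. For m >= 1:
   - if 1 does not occur, deleting the leading 0 and decrementing the positive
     entries is a bijection onto the sequences counted by N(m - 1);
   - if 1 occurs and the last entry is 0, deleting the latter is a bijection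
     onto those counted by U(m - 1);
   - if 1 occurs and the last entry is not 0, deleting the leading 0 and
     decrementing the positive entries is again a bijection onto N(m - 1): as
     102 is avoided, no 0 follows the 1, so the 1 becomes the last 0.
   Hence U(m) = N(m - 1) + U(m - 1) and N(m) = N(m - 1) + U(m), which with
   N(0) = U(0) = 1 gives U(m) = F_(2m+1) and N(m) = F_(2m+2). *)
Require Import Defs.
From mathcomp Require Import all_boot all_order all_algebra.
From mathcomp Require Import zify.

Set Implicit Arguments.
Unset Strict Implicit.
Unset Printing Implicit Defensive.

Implicit Types (s : seq nat) (t m : nat).

(* Indices range over all of nat in the predicates below: positions beyond the
   end read as 0, which violates none of them. *)
Definition bounded s := forall i, nth 0 s i <= i.

Definition no102 s := forall i j k, i < j -> j < k ->
  nth 0 s j < nth 0 s i -> nth 0 s i < nth 0 s k -> False.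

Definition pos_inj s := forall i j, i < j -> 0 < nth 0 s i ->
  nth 0 s i <> nth 0 s j.

(* The 0-based index M + t lies inside s because its entry M is positive. *)
Definition max_at s t M :=
  [/\ 0 < M, nth 0 s (M + t) = M & forall i, nth 0 s i <= M].

Definition good t s :=
  [/\ bounded s, no102 s, pos_inj s & exists M, max_at s t M].

(** * Prepending a 0, the last 0, and the inverse map *)

Definition incr_pos x := if x is 0 then 0 else x.+1.
Definition shift s := 0 :: map incr_pos s.
(** A left inverse of [shift], and of [raise] where 0 occurs: truncated [predn] sends both 0 and 1
    to 0. *)
Definition unshift s := map predn (behead s).
Definition last_zero s := (size s).-1 - index 0 (rev s).
(** The last 0 of [s] reappears as 1; [.+1] accounts for the 0 prepended by [shift]. *)
Definition raise s := set_nth 0 (shift s) (last_zero s).+1 1.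

Lemma nth_shift s i :
  nth 0 (shift s) i = if i is j.+1 then incr_pos (nth 0 s j) else 0.
Proof.
case: i => [//|i] /=; case: (ltnP i (size s)) => hi; first by rewrite (nth_map 0).
by rewrite !nth_default ?size_map.
Qed.

Lemma nth_unshift s i : nth 0 (unshift s) i = (nth 0 s i.+1).-1.
Proof.
rewrite /unshift -nth_behead; case: (ltnP i (size (behead s))) => hi.
  by rewrite (nth_map 0).
by rewrite !nth_default ?size_map.
Qed.

Lemma nth_raise s i :
  nth 0 (raise s) i = if i == (last_zero s).+1 then 1 else nth 0 (shift s) i.
Proof. by rewrite nth_set_nth. Qed.

Lemma size_unshift s : size (unshift s) = (size s).-1.
Proof. by rewrite size_map size_behead. Qed.

Lemma size_shift s : size (shift s) = (size s).+1.
Proof. by rewrite /= size_map. Qed.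

Lemma last_zeroP s : 0 \in s ->
  [/\ last_zero s < size s, nth 0 s (last_zero s) = 0 &
      forall i, last_zero s < i -> i < size s -> 0 < nth 0 s i].
Proof.
move=> h0; have hi : index 0 (rev s) < size s by rewrite -size_rev index_mem mem_rev.
have E : last_zero s = size s - (index 0 (rev s)).+1 by rewrite /last_zero; lia.
split; first by lia.
  by rewrite E -nth_rev // nth_index // mem_rev.
move=> i h1 h2; rewrite lt0n; apply/eqP => h3.
have h4 : size s - i.+1 < index 0 (rev s) by lia.
move: (before_find 0 h4); rewrite nth_rev; last by lia.
have -> : size s - (size s - i.+1).+1 = i by lia.
by rewrite h3.
Qed.

Lemma last_zero_unique s j : j < size s -> nth 0 s j = 0 ->
  (forall i, j < i -> i < size s -> 0 < nth 0 s i) -> last_zero s = j.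
Proof.
move=> hj h0 hp; have m0 : 0 \in s by rewrite -h0 mem_nth.
have [h1 h2 h3] := last_zeroP m0.
case: (ltngtP (last_zero s) j) => // h; first by have := h3 _ h hj; lia.
by have := hp _ h h1; lia.
Qed.

Lemma size_raise s : 0 \in s -> size (raise s) = (size s).+1.
Proof.
move=> /last_zeroP[h _ _]; rewrite size_set_nth size_shift; apply/maxn_idPr; lia.
Qed.

Lemma shiftK : cancel shift unshift.
Proof.
move=> s; apply: (@eq_from_nth _ 0); first by rewrite size_unshift size_shift.
by move=> i _; rewrite nth_unshift nth_shift; case: nth.
Qed.

Lemma raiseK s : 0 \in s -> unshift (raise s) = s.
Proof.
move=> h0; have [h1 h2 h3] := last_zeroP h0.
apply: (@eq_from_nth _ 0); first by rewrite size_unshift size_raise.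
move=> i _; rewrite nth_unshift nth_raise eqSS; case: eqP => [->|_]; first by rewrite h2.
by rewrite nth_shift; case: nth.
Qed.

Lemma bounded_nth0 s : bounded s -> nth 0 s 0 = 0.
Proof. by move=> /(_ 0); lia. Qed.

Lemma bounded_mem0 s : bounded s -> 0 < size s -> 0 \in s.
Proof. by move=> /bounded_nth0 h hs; rewrite -{1}h mem_nth. Qed.

Lemma good_size t s : good t s -> t.+1 < size s.
Proof.
case=> _ _ _ [M [hM hn _]]; case: (ltnP (M + t) (size s)) => h; first by lia.
by move: hn; rewrite nth_default //; lia.
Qed.

Lemma good_mem0 t s : good t s -> 0 \in s.
Proof.
move=> h; have hs := good_size h; case: h => h _ _ _.
by apply: bounded_mem0 => //; lia.
Qed.

(** * Both maps preserve goodness *)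

Lemma good_shift t s : good t s -> good t (shift s).
Proof.
case=> hb h1 h2 [M [hM hn hm]]; split.
- move=> i; rewrite nth_shift; case: i => // i.
  by move: (hb i); case: nth => //=; lia.
- move=> [|i] [|j] [|k] // hij hjk; rewrite !nth_shift // => a b.
  apply: (h1 i j k) => //; move: a b; rewrite /incr_pos; do 3 case: nth => //; lia.
- move=> [|i] [|j] // hij; rewrite !nth_shift // => a b.
  have := h2 i j hij; move: a b; rewrite /incr_pos; do 2 case: nth => //; lia.
exists M.+1; split => //.
  by rewrite addSn nth_shift hn; case: (M) hM.
move=> i; rewrite nth_shift; case: i => // i.
by move: (hm i); case: nth.
Qed.

(** Together these facts determine the entry, since the predecessor confuses only 0 and 1. *)
Lemma nth_raiseS s i : 0 \in s ->
  (nth 0 (raise s) i.+1).-1 = nth 0 s i /\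
  (nth 0 (raise s) i.+1 = 1 <-> i = last_zero s).
Proof.
move=> h0; have [h1 h2 h3] := last_zeroP h0.
rewrite nth_raise eqSS nth_shift; case: eqP => [->|hi]; first by rewrite h2.
by case: nth => [|x] /=; split=> //; split=> //; lia.
Qed.

Lemma good_raise t s : good t s -> good t (raise s).
Proof.
move=> hg; have h0 := good_mem0 hg; have hs := good_size hg.
have R i := nth_raiseS i h0.
have [l1 l2 l3] := last_zeroP h0.
case: hg => hb h1 h2 [M [hM hn hm]]; split.
- by move=> [|i] //; have [a _] := R i; have := hb i; lia.
- move=> [|i] [|j] [|k] // hij hjk.
  have [a a'] := R i; have [b b'] := R j; have [c c'] := R k => u v.
  case: (ltnP 1 (nth 0 (raise s) i.+1)) => w.
    by apply: (h1 i j k) => //; lia.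
  (* An entry 1 comes from the last 0 of [s], so no later entry inside the sequence lies below it;
     past the end, the top entry of the pattern would read 0. *)
  have hi : i = last_zero s by apply/a'; lia.
  case: (ltnP j (size s)) => hj; first by have := l3 j; lia.
  by move: v; rewrite [X in _ < X]nth_default // size_raise //; lia.
- move=> [|i] [|j] // hij.
  have [a a'] := R i; have [b b'] := R j => u v.
  case: (ltnP 1 (nth 0 (raise s) i.+1)) => w; first by apply: (h2 i j); lia.
  have ri : nth 0 (raise s) i.+1 = 1 by lia.
  have rj : nth 0 (raise s) j.+1 = 1 by lia.
  by move: (a'.1 ri) (b'.1 rj); lia.
exists M.+1; split => //.
  by rewrite addSn; have [a a'] := R (M + t); lia.
by case=> // i; have [a _] := R i; have := hm i; lia.
Qed.

Lemma raise_mem1 s : 0 \in s -> 1 \in raise s.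
Proof.
move=> h0; have [l1 _ _] := last_zeroP h0.
have <- : nth 0 (raise s) (last_zero s).+1 = 1 by rewrite nth_raise eqxx.
by rewrite mem_nth // size_raise.
Qed.

Lemma last_raise s : 0 \in s -> last 0 (raise s) != 0.
Proof.
move=> h0; have [l1 l2 l3] := last_zeroP h0.
rewrite -nth_last size_raise //=; case E: (size s) (l1) => [//|k] _.
have [a a'] := nth_raiseS k h0.
case: (ltngtP (last_zero s) k) => h.
- by have := l3 k; lia.
- by lia.
- by rewrite a'.2.
Qed.

Lemma shift_mem1 s : 1 \notin shift s.
Proof. by rewrite inE /=; apply/mapP => -[[|x]]. Qed.

(** * Inverting the maps *)

(** Value and index of the maximum both drop by one, so [t] is kept; [1 < M] leaves the new maximum
    positive. *)
Lemma good_unshift t s M : good t s -> max_at s t M -> 1 < M ->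
  good t (unshift s).
Proof.
case=> hb h1 h2 _ [_ hn hm] hM; split.
- by move=> i; rewrite nth_unshift; have := hb i.+1; lia.
- move=> i j k hij hjk; rewrite !nth_unshift => a b.
  by apply: (h1 i.+1 j.+1 k.+1) => //; lia.
- move=> i j hij; rewrite !nth_unshift => a b.
  by apply: (h2 i.+1 j.+1) => //; lia.
exists M.-1; split; first by lia.
  by rewrite nth_unshift -addSn prednK ?hn // ltnW.
by move=> i; rewrite nth_unshift; have := hm i.+1; lia.
Qed.

Lemma unshiftK_shift t s : good t s -> 1 \notin s -> shift (unshift s) = s.
Proof.
move=> hg h1; have hs := good_size hg; case: hg => /bounded_nth0 hb _ _ _.
apply: (@eq_from_nth _ 0); rewrite size_shift size_unshift; first by lia.
move=> [|i] hi; rewrite nth_shift ?hb // nth_unshift.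
have {}hi : i.+1 < size s by lia.
have : nth 0 s i.+1 != 1 by apply: contraNneq h1 => <-; apply: mem_nth.
by case: nth => [|[]].
Qed.

Lemma unshiftK_raise t s : good t s -> 1 \in s -> last 0 s != 0 ->
  raise (unshift s) = s.
Proof.
move=> hg mem1 hl; have hs := good_size hg; case: hg => hb h102 hp _.
have [[|j] hj h1] : exists2 i, i < size s & nth 0 s i = 1 by apply/(nthP 0).
  by have := hb 0; rewrite h1.
(* A 0 after the 1 would form 102 with the last entry, which is nonzero and, by distinctness, not
   1. *)
have pos i : j.+1 < i -> i < size s -> 1 < nth 0 s i.
  move=> hji hi; have d : nth 0 s i <> 1 by have := hp _ _ hji; lia.
  case: (posnP (nth 0 s i)) => [z|]; last by lia.
  move: hl; rewrite -nth_last => hl.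
  have d' := hp j.+1 (size s).-1.
  have li : i <> (size s).-1 by move=> e; move: hl; rewrite -e z.
  by case: (h102 j.+1 i (size s).-1) => //; lia.
have hz : last_zero (unshift s) = j.
  apply: last_zero_unique; rewrite ?size_unshift ?nth_unshift ?h1 //; first by lia.
  by move=> i hji hi; rewrite nth_unshift; have := pos i.+1; lia.
have m0 : 0 \in unshift s.
  have <- : nth 0 (unshift s) j = 0 by rewrite nth_unshift h1.
  by rewrite mem_nth // size_unshift; lia.
apply: (@eq_from_nth _ 0); rewrite size_raise ?size_unshift //; first by lia.
move=> [|i] hi; first by rewrite (bounded_nth0 hb).
have [a a'] := nth_raiseS i m0; move: a; rewrite nth_unshift.
rewrite hz in a'; case: (eqVneq i j) => [e|ne]; first by rewrite a'.2 // e h1.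
have n1 : nth 0 (raise (unshift s)) i.+1 <> 1 by move/a'; lia.
(* The two entries have equal predecessors, so they agree once neither is 1. *)
suff : nth 0 s i.+1 <> 1 by lia.
move=> e; case: (ltngtP i j) => h; last by rewrite h eqxx in ne.
  by apply: (hp i.+1 j.+1); rewrite ?e ?h1.
by apply: (hp j.+1 i.+1); rewrite ?e ?h1.
Qed.

(** * Recursive enumeration without repetition *)

Lemma nth_rcons0 s i : nth 0 (rcons s 0) i = nth 0 s i.
Proof. by rewrite nth_rcons; case: ltngtP => // h; rewrite nth_default //; lia. Qed.

(** [good] reads entries through [nth 0] and never the length, so a trailing 0 is invisible to
    it. *)
Lemma good_eq_nth t s1 s2 : nth 0 s1 =1 nth 0 s2 -> good t s1 -> good t s2.
Proof.
move=> E [hb h1 h2 [M [hM hn hm]]]; split.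
- by move=> i; rewrite -E.
- by move=> i j k; rewrite -!E; apply: h1.
- by move=> i j; rewrite -!E; apply: h2.
by exists M; split => // [|i]; rewrite -E.
Qed.

Lemma good_rcons0 t s : good t (rcons s 0) <-> good t s.
Proof. by split; apply: good_eq_nth => i; rewrite nth_rcons0. Qed.

Definition minimal_seq t := rcons (nseq t.+1 0) 1.

(* First component: all good sequences of length m + t + 2; second component:
   those containing 1. *)
Fixpoint good_seqs t m : seq (seq nat) * seq (seq nat) :=
  if m is m'.+1 then
    let: (all_prev, one_prev) := good_seqs t m' in
    let one := map raise all_prev ++ map (rcons^~ 0) one_prev in
    (map shift all_prev ++ one, one)
  else ([:: minimal_seq t], [:: minimal_seq t]).

Lemma nth_minimal_seq t i : nth 0 (minimal_seq t) i = (i == t.+1).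
Proof.
rewrite /minimal_seq nth_rcons size_nseq nth_nseq.
by case: ltngtP.
Qed.

Lemma good_minimal_seq t : good t (minimal_seq t).
Proof.
split.
- by move=> i; rewrite nth_minimal_seq; case: eqP => /=; lia.
- by move=> i j k; rewrite !nth_minimal_seq; do 3 case: eqP => /=; lia.
- by move=> i j; rewrite !nth_minimal_seq; do 2 case: eqP => /=; lia.
exists 1; split => // [|i]; rewrite nth_minimal_seq; last by case: eqP.
by rewrite add1n eqxx.
Qed.

(** The index [M + t] lies below [t.+2], forcing [M = 1] at the last index; distinctness makes all
    other entries 0. *)
Lemma minimal_seq_unique t s : size s = t.+2 -> good t s -> s = minimal_seq t.
Proof.
move=> hs [hb h1 h2 [M [hM hn hm]]].
have M1 : M = 1.
  by case: (ltnP 1 M) => h; [move: hn; rewrite nth_default; lia | lia].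
subst M; rewrite add1n in hn.
apply: (@eq_from_nth _ 0); first by rewrite size_rcons size_nseq.
rewrite hs => i hi; rewrite nth_minimal_seq; case: eqP => [->//|ne].
have := h2 i t.+1; have := hm i; rewrite hn; lia.
Qed.

Lemma good_seqsP t m s :
  (s \in (good_seqs t m).1 <-> size s = m + t.+2 /\ good t s) /\
  (s \in (good_seqs t m).2 <-> [/\ size s = m + t.+2, good t s & 1 \in s]).
Proof.
elim: m s => [|m IH] s /=.
  have A : s \in [:: minimal_seq t] <-> size s = t.+2 /\ good t s.
    rewrite inE; split=> [/eqP->|[h1 h2]]; last by apply/eqP/minimal_seq_unique.
    by split; [rewrite size_rcons size_nseq | apply: good_minimal_seq].
  split=> //; split=> [h|[h1 h2 _]]; last by apply/A.
  have [h1 h2] := A.1 h; split=> //.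
  by move: h; rewrite inE => /eqP->; rewrite mem_rcons inE eqxx.
case E: (good_seqs t m) => [a b] /=; rewrite E /= in IH.
have B : s \in map raise a ++ map (rcons^~ 0) b <->
    [/\ size s = m.+1 + t.+2, good t s & 1 \in s].
  rewrite mem_cat; split.
    case/orP=> /mapP[r hr ->].
      have [/(_ hr) [h1 h2] _] := (IH r).1; have h0 := good_mem0 h2.
      by rewrite size_raise // h1 raise_mem1 //; split=> //; apply: good_raise.
    have [/(_ hr) [h1 h2 h3] _] := (IH r).2.
    rewrite size_rcons h1 mem_rcons inE h3; split=> //.
    by apply/good_rcons0.
  (* The last entry tells which of the two maps produced [s]. *)
  case=> h1 h2 h3; case: (eqVneq (last 0 s) 0) => hl; apply/orP; [right|left].
    case/lastP: s h1 h2 h3 hl => [//|s x]; rewrite last_rcons size_rcons.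
    move=> h1 h2 h3 e; subst x; apply/mapP; exists s => //.
    apply/(IH s).2; split; [lia | exact/good_rcons0 |].
    by move: h3; rewrite mem_rcons inE.
  apply/mapP; exists (unshift s); last by rewrite (unshiftK_raise h2).
  apply/(IH _).1; rewrite size_unshift h1; split=> //.
  case: (h2) => hb h102 hp [M hM]; apply: (good_unshift h2 hM).
  (* Were [M] equal to 1, the nonzero last entry would be 1 as well, hence sit at index [1 + t]; the
     length exceeds [t.+2]. *)
  case: hM => hM hn hm; rewrite ltnNge; apply/negP => M1.
  have {}M1 : M = 1 by lia.
  subst M; move: hl; rewrite -nth_last => hl.
  have := hp (1 + t) (size s).-1; have := hm (size s).-1; rewrite hn; lia.
split=> //; rewrite mem_cat; split.
  case/orP=> [/mapP[r hr ->]|/B[]//].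
  have [/(_ hr) [h1 h2] _] := (IH r).1.
  by rewrite size_shift h1; split=> //; apply: good_shift.
case=> h1 h2; apply/orP; case: (boolP (1 \in s)) => h3; [right|left].
  by apply/B.
apply/mapP; exists (unshift s); last by rewrite (unshiftK_shift h2).
apply/(IH _).1; rewrite size_unshift h1; split=> //.
case: (h2) => hb h102 hp [M hM]; apply: (good_unshift h2 hM).
case: hM => hM hn hm; rewrite ltnNge; apply/negP => M1.
have {}M1 : M = 1 by lia.
by subst M; case/negP: h3; rewrite -hn; apply: mem_nth; apply: (good_size h2).
Qed.

(** Each map is injective where used, and the images are disjoint: 1 never occurs after [shift], and
    the last entry separates [raise] from appending 0. *)
Lemma good_seqs_uniq t m : uniq (good_seqs t m).1 /\ uniq (good_seqs t m).2.
Proof.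
elim: m => [|m] //=.
have := good_seqsP t m; case: (good_seqs t m) => a b /= hab [ua ub].
have a0 r : r \in a -> 0 \in r by case/(hab r).1 => _ /good_mem0.
have inj : {in a &, injective raise}.
  by move=> x y /a0 hx /a0 hy e; rewrite -(raiseK hx) e raiseK.
have B : uniq (map raise a ++ map (rcons^~ 0) b).
  rewrite cat_uniq map_inj_in_uniq // ua map_inj_uniq ?ub; last first.
    by move=> x y /rcons_inj [].
  rewrite andbT /=; apply/hasPn => _ /mapP[r hr ->]; apply/mapP=> -[q /a0 hq e].
  by have := last_raise hq; rewrite -e last_rcons.
split=> //; rewrite cat_uniq B (map_inj_uniq (can_inj shiftK)) ua andbT /=.
apply/hasPn => q hq; apply/mapP=> -[r hr e]; subst q.
have := shift_mem1 r; move: hq; rewrite mem_cat => /orP[] /mapP[q hq ->].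
  by rewrite raise_mem1 // a0.
by have [_ _ h] := (hab q).2.1 hq; rewrite mem_rcons inE h.
Qed.

(** * Fibonacci sizes *)

Lemma fibSS k : fib k.+2 = fib k.+1 + fib k.
Proof. by []. Qed.

Lemma size_good_seqs t m :
  size (good_seqs t m).1 = fib (2 * m).+2 /\
  size (good_seqs t m).2 = fib (2 * m).+1.
Proof.
elim: m => [//|m]; rewrite mulnS add2n [good_seqs t m.+1]/=.
case: (good_seqs t m) => a b; rewrite [(_, _).1]/= [(_, _).2]/= => -[ha hb].
rewrite [(_, _).1]/= [(_, _).2]/= !size_cat !size_map ha hb.
by rewrite !fibSS; split; lia.
Qed.

(** * Pattern avoidance in terms of indices *)

Lemma inversion_seqP s : reflect (bounded s) (inversion_seq s).
Proof.
apply: (iffP forallP) => [h i|h i]; last exact: h.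
case: (ltnP i (size s)) => hi; first exact: (h (Ordinal hi)).
by rewrite nth_default.
Qed.

Lemma order_iso102 a b c : order_iso [:: a; b; c] [:: 1; 0; 2] = (b < a < c).
Proof.
rewrite /order_iso /=; apply/idP/idP => [/forallP H|h].
  move: (forallP (H (@Ordinal 3 0 isT)) (@Ordinal 3 1 isT)).
  move: (forallP (H (@Ordinal 3 0 isT)) (@Ordinal 3 2 isT)) => /=.
  move: (forallP (H (@Ordinal 3 1 isT)) (@Ordinal 3 0 isT)) => /=.
  by lia.
by apply/forallP; case=> [[|[|[|//]]] hi]; apply/forallP;
  case=> [[|[|[|//]]] hj] /=; lia.
Qed.

Lemma order_iso011 a b c :
  order_iso [:: a; b; c] [:: 0; 1; 1] = (a < b) && (b == c).
Proof.
rewrite /order_iso /=; apply/idP/idP => [/forallP H|h].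
  move: (forallP (H (@Ordinal 3 0 isT)) (@Ordinal 3 1 isT)).
  move: (forallP (H (@Ordinal 3 1 isT)) (@Ordinal 3 2 isT)) => /=.
  by lia.
by apply/forallP; case=> [[|[|[|//]]] hi]; apply/forallP;
  case=> [[|[|[|//]]] hj] /=; lia.
Qed.

Lemma avoids_lt w s i j k : avoids w s -> i < j -> j < k -> k < size s ->
  ~~ order_iso [:: nth 0 s i; nth 0 s j; nth 0 s k] w.
Proof.
move=> h hij hjk hk; apply: contra h => h.
have hj := ltn_trans hjk hk; have hi := ltn_trans hij hj.
apply/existsP; exists (Ordinal hi); apply/existsP; exists (Ordinal hj).
by apply/existsP; exists (Ordinal hk); rewrite /= hij hjk.
Qed.

Lemma avoids102P s : reflect (no102 s) (avoids [:: 1; 0; 2] s).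
Proof.
apply: (iffP idP) => [h i j k hij hjk a b|h].
  case: (ltnP k (size s)) => hk; last by move: b; rewrite [X in _ < X]nth_default.
  by have := avoids_lt h hij hjk hk; rewrite order_iso102 a b.
apply/existsP => -[i /existsP[j /existsP[k]]].
by rewrite order_iso102 => /and4P[hij hjk a b]; apply: (h i j k).
Qed.

(** The leading entry is 0, so it completes any two equal positive entries to 011. *)
Lemma avoids011P s : bounded s -> reflect (pos_inj s) (avoids [:: 0; 1; 1] s).
Proof.
move=> hb; apply: (iffP idP) => [h i j hij a b|h].
  case: (ltnP j (size s)) => hj; last by move: a; rewrite b nth_default.
  have h0 := bounded_nth0 hb.
  case: i hij a b => [|i] hij a b; first by lia.
  have := @avoids_lt _ _ 0 _ _ h (ltn0Sn i) hij hj.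
  by rewrite order_iso011 h0 a b eqxx.
apply/existsP => -[i /existsP[j /existsP[k]]].
rewrite order_iso011 => /and4P[hij hjk a /eqP b].
by apply: (h j k) => //; lia.
Qed.

(** * Maximum, first descent and rank *)

Lemma maxe_eq s M : M \in s -> (forall i, nth 0 s i <= M) -> maxe s = M.
Proof.
move=> hM h; apply/eqP; rewrite eqn_leq; apply/andP; split.
  by apply/bigmax_leqP_seq => x /(nthP 0)[i _ <-].
exact: leq_bigmax_seq.
Qed.

(** The first disjunct is the convention that -1 follows the last entry. *)
Definition descent s p := (p.+1 == size s) || (nth 0 s p.+1 < nth 0 s p).

Lemma fdesE s : fdes s = (find (descent s) (iota 0 (size s))).+1.
Proof.
rewrite /fdes /=; congr _.+1; apply: eq_in_find => p; rewrite mem_iota /= => hp.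
rewrite /descent [X in (_ < X)%R](nth_map 0) //; case: (eqVneq p.+1 (size s)) => h.
  by rewrite nth_default // size_map h.
by rewrite (nth_map 0) //; lia.
Qed.

Lemma fdes_eq s p : p < size s -> descent s p ->
  (forall q, q < p -> ~~ descent s q) -> fdes s = p.+1.
Proof.
move=> hp h1 h2; rewrite fdesE; congr _.+1.
have hh : has (descent s) (iota 0 (size s)).
  by apply/hasP; exists p => //; rewrite mem_iota.
have hf := hh; rewrite has_find size_iota in hf.
have := nth_find 0 hh; rewrite nth_iota // => h3.
case: (ltngtP (find (descent s) (iota 0 (size s))) p) => // h.
  by case/negP: (h2 _ h).
by have := before_find 0 h; rewrite nth_iota // h1.
Qed.

Lemma fdesP s : 0 < size s -> exists p,
  [/\ fdes s = p.+1, p < size s, descent s p &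
      forall q, q < p -> ~~ descent s q].
Proof.
move=> hs; have hex : exists p, (p < size s) && descent s p.
  by exists (size s).-1; rewrite /descent prednK // leqnn eqxx.
case: (ex_minnP hex) => p /andP[hp hd] hmin; exists p.
have H q : q < p -> ~~ descent s q.
  move=> hq; apply/negP => h; have := hmin q; rewrite h andbT; lia.
by split=> //; apply: fdes_eq.
Qed.

(** The maximum is followed by a smaller entry or the end. A descent at an earlier [q] would form
    102 with the maximum at [M + t]. *)
Lemma rank_good t s : good t s -> rank s = Posz t.
Proof.
move=> hg; have hs := good_size hg; case: hg => hb h1 h2 [M [hM hn hm]].
have hp : M + t < size s.
  by case: (ltnP (M + t) (size s)) => // h; move: hn; rewrite nth_default //; lia.
have -> : rank s = (Posz (M + t).+1 - Posz M - 1)%R; last by lia.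
rewrite /rank; congr (_ - Posz _ - _)%R; last first.
  by apply: maxe_eq => //; rewrite -{1}hn mem_nth.
congr Posz; apply: fdes_eq => //.
  rewrite /descent; case: eqP => //= h.
  by have := h2 (M + t) (M + t).+1; have := hm (M + t).+1; lia.
move=> q hq; rewrite /descent negb_or; apply/andP; split; first by lia.
apply/negP => h; have := hm q => h3.
case: (eqVneq q.+1 (M + t)) => e; first by move: h; rewrite e hn; lia.
apply: (h1 q q.+1 (M + t)) => //; first by lia.
by have := h2 q (M + t); lia.
Qed.

(** Entries increase weakly up to the first descent [p], and a later one above [nth 0 s p] would
    form 102 with indices [p] and [p.+1]. So the maximum is at [p], and the rank gives
    [p = M + t]. *)
Lemma good_of_rank t s : t.+1 < size s -> bounded s -> no102 s -> pos_inj s ->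
  rank s = Posz t -> good t s.
Proof.
move=> hs hb h1 h2 hr; split=> //.
have [|p [hf hp hd hq]] := @fdesP s; first by lia.
have mono q : q <= p -> nth 0 s q <= nth 0 s p.
  move=> hle; have {hle} : exists d, p = q + d by exists (p - q); lia.
  case=> d; elim: d q => [|d IH] q e; first by rewrite e addn0.
  have := hq q; rewrite /descent negb_or -leqNgt => h.
  have /andP[_ h3] := h ltac:(lia).
  by apply: leq_trans h3 _; apply: IH; lia.
have hm i : nth 0 s i <= nth 0 s p.
  case: (leqP i p) => hi; first exact: mono.
  case: (ltnP i (size s)) => his; last by rewrite nth_default.
  have hd' : nth 0 s p.+1 < nth 0 s p by move: hd; rewrite /descent; lia.
  case: (eqVneq i p.+1) => [->|ne]; first by lia.
  rewrite leqNgt; apply/negP => h.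
  by apply: (h1 p p.+1 i) => //; lia.
have hM : maxe s = nth 0 s p by apply: maxe_eq => //; apply: mem_nth.
move: hr; rewrite /rank hf hM => hr.
exists (nth 0 s p); split=> //; last first.
  by have <- : p = nth 0 s p + t by lia.
(* With maximum 0 the descent at [p] could only be the end of the sequence, giving length [t.+1]. *)
rewrite lt0n; apply/eqP => z.
move: hd; rewrite /descent z ltn0 orbF => /eqP; lia.
Qed.

(** * Transfer to tuples and cardinality *)

Theorem proposition5p4 (n t : nat) (hn : 2 <= n) (ht : t <= n - 2) :
  #|avoiders_of_rank n t| = fib (2 * n - 2 * t - 2).
Proof.
have [m em] : exists m, n = m + t.+2 by exists (n - t - 2); lia.
have -> : 2 * n - 2 * t - 2 = (2 * m).+2 by lia.
have [<- _] := size_good_seqs t m; have [uL _] := good_seqs_uniq t m.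
pose f (u : n.-tuple 'I_n) := [seq val x | x <- u].
have finj : injective f.
  by move=> x y h; apply/val_inj/(inj_map val_inj).
rewrite cardE -(size_map f); apply/perm_size/uniq_perm => //.
  by rewrite map_inj_uniq ?enum_uniq.
move=> s; apply/idP/idP.
  case/mapP=> u; rewrite mem_enum inE -/(f u).
  have sz : size (f u) = n by rewrite size_map size_tuple.
  case/and4P=> /inversion_seqP h1 /avoids102P h2 /(avoids011P h1) h3 /eqP h4 ->.
  apply/(good_seqsP t m _).1; split; first by rewrite sz.
  by apply: good_of_rank => //; rewrite sz; lia.
case/(good_seqsP t m _).1 => sz hg; have hr := rank_good hg.
have [hb h1 h2 _] := hg.
have hn0 : 0 < n by lia.
(* Entry [i] is at most [i], hence below [n], so it is an ordinal. *)
pose u := [tuple (Ordinal (leq_ltn_trans (hb i) (ltn_ord i))) | i < n].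
have fu : f u = s.
  apply: (@eq_from_nth _ 0); first by rewrite size_map size_tuple sz.
  rewrite size_map size_tuple => i hi.
  rewrite (nth_map (Ordinal hn0)) ?size_tuple //.
  by rewrite -(tnth_nth _ u (Ordinal hi)) tnth_mktuple.
apply/mapP; exists u; last by [].
rewrite mem_enum inE -/(f u) fu /= hr eqxx andbT.
by apply/and3P; split; [apply/inversion_seqP | apply/avoids102P | apply/avoids011P].
Qed.
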